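(* Let $f:\mathbb{R}^n\to\mathbb{R}$ be bounded below and continuously differentiable with $\nabla f$ Lipschitz with constant $L_{\nabla f}$, and let $\tilde f$ satisfy $|\tilde f(z)-f(z)|\le\epsilon_f$ for all $z$, for some $\epsilon_f>0$. Let $x\in\mathbb{R}^n$, $\Delta>0$, points $y_1,\ldots,y_p$ with $\|y_i-x\|\le\beta\Delta$ for some $\beta>0$ and all $i$, with $\hat F$ invertible, and let $m(y)=c+g^T(y-x)+\tfrac12(y-x)^TH(y-x)$ be the minimum Frobenius norm quadratic interpolant to the values $\tilde f(y_1),\ldots,\tilde f(y_p)$ (see context). Then $\|H\|\le\kappa_H:=\frac{L_{\nabla f}}{2}p\beta^4\|\hat F^{-1}\|_\infty+\frac{\epsilon_f}{\Delta^2}p\beta^2\|\hat F^{-1}\|_\infty$, and for all $y\in B(x,\Delta)$, $$|m(y)-f(y)|\le\kappa_{\mathrm{mf}}\Delta^2+\tilde\kappa_{\mathrm{mf}}\epsilon_f,\qquad\|\nabla m(y)-\nabla f(y)\|\le\kappa_{\mathrm{mg}}\Delta+\tilde\kappa_{\mathrm{mg}}\frac{\epsilon_f}{\Delta},$$ where $\kappa_{\mathrm{mf}}=\frac{L_{\nabla f}+\kappa_H}{2}(1+\sqrt n)\beta^2\|\hat M^\dagger\|_\infty+\frac{L_{\nabla f}+\kappa_H}{2}$, $\tilde\kappa_{\mathrm{mf}}=(1+\sqrt n)\|\hat M^\dagger\|_\infty$, $\kappa_{\mathrm{mg}}=2\kappa_{\mathrm{mf}}+2\kappa_H$ and $\t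ilde\kappa_{\mathrm{mg}}=2\tilde\kappa_{\mathrm{mf}}$.
   Context: Here $n+2\le p\le(n+1)(n+2)/2-1$. Let $\hat s_i=(y_i-x)/\Delta$, $\hat M\in\mathbb{R}^{p\times(n+1)}$ with rows $[1,\hat s_i^T]$ and Moore–Penrose pseudoinverse $\hat M^\dagger$, $\hat P_{ij}=\tfrac12(\hat s_i^T\hat s_j)^2$, $\hat F=\begin{bmatrix}\hat P&\hat M\\ \hat M^T&0\end{bmatrix}$. The minimum Frobenius norm interpolant to values $v_1,\ldots,v_p$ is $q(y)=c+g^T(y-x)+\tfrac12(y-x)^TH(y-x)$ with $H$ symmetric minimizing $\tfrac14\|H\|_F^2$ subject to $q(y_i)=v_i$; when $\hat F$ is invertible it is obtained by solving $\hat F[\hat\lambda;c;\Delta g]=[v;0;0_n]$ and $H=\sum_i(\hat\lambda_i/\Delta^4)(y_i-x)(y_i-x)^T$. $\|A\|_\infty$ is the maximum absolute row sum; $B(x,\Delta)=\{y:\|y-x\|\le\Delta\}$. *)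

(* Defs.v *)
From HB Require Import structures.
From mathcomp Require Import all_boot all_order all_algebra.
From mathcomp Require Import all_classical all_reals all_analysis.
Set Implicit Arguments. Unset Strict Implicit. Unset Printing Implicit Defensive.
Import Order.TTheory GRing.Theory Num.Theory.
Import numFieldNormedType.Exports.
Local Open Scope classical_set_scope.
Local Open Scope ring_scope.

Section Defs.
Variable R : realType.

Definition enorm (n : nat) (v : 'cV[R]_n) : R :=
  Num.sqrt (\sum_(i < n) v i 0 ^+ 2).

Definition dotv (n : nat) (u v : 'cV[R]_n) : R := (u^T *m v) 0 0.

Definition infnorm (m k : nat) (A : 'M[R]_(m, k)) : R :=
  \big[Num.max/0]_(i < m) \sum_(j < k) `|A i j|.

Definition opnorm2 (n : nat) (H : 'M[R]_n) : R :=
  sup [set enorm (H *m v) | v in [set v : 'cV[R]_n | enorm v <= 1]].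

Definition frob2 (n : nat) (H : 'M[R]_n) : R :=
  \sum_(i < n) \sum_(j < n) H i j ^+ 2.

Definition is_MP_pinv (m k : nat) (A : 'M[R]_(m, k)) (X : 'M[R]_(k, m)) : Prop :=
  [/\ A *m X *m A = A, X *m A *m X = X, (A *m X)^T = A *m X & (X *m A)^T = X *m A].

Definition grad (n : nat) (f : 'cV[R]_n -> R) (z : 'cV[R]_n) : 'cV[R]_n :=
  \col_(i < n) ('D_(delta_mx i 0 : 'cV[R]_n) f z).

Definition quad (n : nat) (c : R) (g : 'cV[R]_n) (H : 'M[R]_n) (x y : 'cV[R]_n) : R :=
  c + dotv g (y - x) + 2^-1 * ((y - x)^T *m H *m (y - x)) 0 0.

Definition is_mfn_interp (n p : nat) (x : 'cV[R]_n) (Y : 'I_p -> 'cV[R]_n)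
  (v : 'I_p -> R) (c : R) (g : 'cV[R]_n) (H : 'M[R]_n) : Prop :=
  [/\ H^T = H, (forall i, quad c g H x (Y i) = v i) &
      forall c' g' H', H'^T = H' -> (forall i, quad c' g' H' x (Y i) = v i) ->
        4^-1 * frob2 H <= 4^-1 * frob2 H'].

Definition shat (n p : nat) (x : 'cV[R]_n) (Delta : R) (Y : 'I_p -> 'cV[R]_n) (i : 'I_p)
  : 'cV[R]_n := Delta^-1 *: (Y i - x).

Definition Mhat (n p : nat) (x : 'cV[R]_n) (Delta : R) (Y : 'I_p -> 'cV[R]_n)
  : 'M[R]_(p, 1 + n) :=
  row_mx (const_mx 1) (\matrix_(i < p, j < n) shat x Delta Y i j 0).

Definition Phat (n p : nat) (x : 'cV[R]_n) (Delta : R) (Y : 'I_p -> 'cV[R]_n)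
  : 'M[R]_p :=
  \matrix_(i < p, j < p) (2^-1 * (dotv (shat x Delta Y i) (shat x Delta Y j)) ^+ 2).

Definition Fhat (n p : nat) (x : 'cV[R]_n) (Delta : R) (Y : 'I_p -> 'cV[R]_n)
  : 'M[R]_(p + (1 + n)) :=
  block_mx (Phat x Delta Y) (Mhat x Delta Y) (Mhat x Delta Y)^T 0.

End Defs.

(* Main.v *)
(* Subtracting the first-order Taylor polynomial of [f] at [x] from the data does
   not change the Hessian of the minimum Frobenius norm interpolant and leaves
   residuals of size [Lg / 2 * beta^2 * Delta^2 + epsf]. The KKT system with matrix
   [Fhat] then bounds the multipliers, and [H] is a combination of the rank-one
   matrices [(y_i - x)(y_i - x)^T] with these multipliers as weights, which gives
   [kH]. With [H] bounded, the interpolation conditions are a linear system with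
   matrix [Mhat] for [(c - f x, Delta (g - grad f x))]; as [Mhat] is injective,
   [Md] is a left inverse of it, and the errors at [y] follow from those at [x] by
   Taylor's formula. *)
Require Import Defs.
From HB Require Import structures.
From mathcomp Require Import all_boot all_order all_algebra.
From mathcomp Require Import all_classical all_reals all_analysis.
From mathcomp Require Import ring lra.
Import Order.TTheory GRing.Theory Num.Theory.
Import numFieldNormedType.Exports.
Local Open Scope classical_set_scope.
Local Open Scope ring_scope.

Section MinimumFrobeniusNorm.
Set Implicit Arguments.
Unset Strict Implicit.

(** * Inner product and Euclidean norm of column vectors *)

Section EuclideanNorm.
Variable (R : realType) (n : nat).
Implicit Types u v w : 'cV[R]_n.

Lemma dotvE u v : dotv u v = \sum_i u i 0 * v i 0.
Proof. by rewrite /dotv mxE; apply: eq_bigr => i _; rewrite mxE. Qed.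

Lemma dotvC u v : dotv u v = dotv v u.
Proof. by rewrite !dotvE; apply: eq_bigr => i _; rewrite mulrC. Qed.

Lemma dotvDr u v w : dotv u (v + w) = dotv u v + dotv u w.
Proof. by rewrite /dotv mulmxDr mxE. Qed.

Lemma dotvZr a u v : dotv u (a *: v) = a * dotv u v.
Proof. by rewrite /dotv -scalemxAr mxE. Qed.

Lemma dotvDl u v w : dotv (u + v) w = dotv u w + dotv v w.
Proof. by rewrite dotvC dotvDr !(dotvC w). Qed.

Lemma dotvZl a u v : dotv (a *: u) v = a * dotv u v.
Proof. by rewrite dotvC dotvZr (dotvC v). Qed.

Lemma dotvBl u v w : dotv (u - v) w = dotv u w - dotv v w.
Proof. by rewrite dotvDl -scaleN1r dotvZl mulN1r. Qed.

Lemma dotvBr u v w : dotv u (v - w) = dotv u v - dotv u w.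
Proof. by rewrite dotvC dotvBl !(dotvC u). Qed.

Lemma dotv_deltal (i : 'I_n) v : dotv (delta_mx i 0) v = v i 0.
Proof. by rewrite /dotv trmx_delta -rowE !mxE. Qed.

Lemma dotv_mulmx u (H : 'M[R]_n) v : dotv u (H *m v) = dotv (H^T *m u) v.
Proof. by rewrite /dotv trmx_mul trmxK mulmxA. Qed.

Lemma enorm_ge0 v : 0 <= enorm v.
Proof. exact: sqrtr_ge0. Qed.

Lemma enorm_sq v : enorm v ^+ 2 = dotv v v.
Proof.
rewrite sqr_sqrtr; last by apply: sumr_ge0 => i _; apply: sqr_ge0.
by rewrite dotvE; apply: eq_bigr => i _; rewrite expr2.
Qed.

Lemma enorm0 : enorm (0 : 'cV[R]_n) = 0.
Proof. by rewrite /enorm big1 ?sqrtr0 // => i _; rewrite mxE expr0n. Qed.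

Lemma enormZ a v : enorm (a *: v) = `|a| * enorm v.
Proof.
rewrite /enorm -sqrtr_sqr -sqrtrM ?sqr_ge0 // mulr_sumr; congr Num.sqrt.
by apply: eq_bigr => i _; rewrite mxE exprMn.
Qed.

(** Cauchy-Schwarz: for vectors of nonzero norm, expand the squared norm of
    [enorm v *: u - enorm u *: v] and cancel the factor [enorm u * enorm v]. *)
Lemma dotv_le_enorm u v : dotv u v <= enorm u * enorm v.
Proof.
have [v0|v0] := eqVneq (enorm v) 0.
  have : dotv v v == 0 by rewrite -enorm_sq v0 expr0n.
  rewrite dotvE psumr_eq0 => [/allP vi|i _]; last by rewrite -expr2 sqr_ge0.
  rewrite v0 mulr0 dotvE big1 // => i _.
  by have := vi i (mem_index_enum _); rewrite mulf_eq0 orbb => /eqP->; rewrite mulr0.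
have [u0|u0] := eqVneq (enorm u) 0.
  have : dotv u u == 0 by rewrite -enorm_sq u0 expr0n.
  rewrite dotvE psumr_eq0 => [/allP ui|i _]; last by rewrite -expr2 sqr_ge0.
  rewrite u0 mul0r dotvE big1 // => i _.
  by have := ui i (mem_index_enum _); rewrite mulf_eq0 orbb => /eqP->; rewrite mul0r.
have vp : 0 < enorm v by rewrite lt_neqAle eq_sym v0 enorm_ge0.
have up : 0 < enorm u by rewrite lt_neqAle eq_sym u0 enorm_ge0.
have := sqr_ge0 (enorm (enorm v *: u + - enorm u *: v)).
rewrite enorm_sq dotvDl !dotvDr !dotvZl !dotvZr (dotvC v u) -!enorm_sq => h.
rewrite -(ler_pM2l (mulr_gt0 up vp)); lra.
Qed.

Lemma normr_dotv_le u v : `|dotv u v| <= enorm u * enorm v.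
Proof.
rewrite ler_norml dotv_le_enorm andbT lerNl -mulN1r -dotvZl.
by apply: le_trans (dotv_le_enorm _ _) _; rewrite enormZ normrN1 mul1r.
Qed.

Lemma enormD u v : enorm (u + v) <= enorm u + enorm v.
Proof.
rewrite -(@ler_pXn2r _ 2) ?nnegrE ?addr_ge0 ?enorm_ge0 //.
rewrite enorm_sq dotvDl !dotvDr (dotvC v u) -!enorm_sq.
have := dotv_le_enorm u v; lra.
Qed.

Lemma enormB u v : enorm (u - v) = enorm (v - u).
Proof. by rewrite -opprB -scaleN1r enormZ normrN1 mul1r. Qed.

Lemma enorm_sum (I : finType) (F : I -> 'cV[R]_n) :
  enorm (\sum_i F i) <= \sum_i enorm (F i).
Proof.
elim/big_rec2: _ => [|i y1 y2 _ le12]; first by rewrite enorm0.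
by apply: le_trans (enormD _ _) _; rewrite lerD2l.
Qed.

(** Source of the factor [sqrt n] in the constants. Any entry forces [0 <= b]; for [n = 0] both
    sides vanish. *)
Lemma enorm_le_sqrt v b : (forall i, `|v i 0| <= b) -> enorm v <= Num.sqrt n%:R * b.
Proof.
case: n v => [|k] v vb; first by rewrite /enorm big_ord0 !sqrtr0 mul0r.
have b0 : 0 <= b by apply: le_trans (vb ord0).
rewrite -[b]ger0_norm // -sqrtr_sqr -sqrtrM ?ler0n // ler_sqrt; last first.
  by rewrite mulr_ge0 ?ler0n ?sqr_ge0.
rewrite -[X in X%:R]card_ord mulr_natl -sumr_const ler_sum // => i _.
by rewrite -ler_sqrt ?sqr_ge0 // !sqrtr_sqr (ger0_norm b0).
Qed.

End EuclideanNorm.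

(** * Row-sum norm and operator norm *)

Lemma infnorm_mulmx_le (R : realType) (m k : nat) (A : 'M[R]_(m, k)) (w : 'cV[R]_k)
  (b : R) : 0 <= b -> (forall j, `|w j 0| <= b) ->
  forall i, `|(A *m w) i 0| <= infnorm A * b.
Proof.
move=> b0 wb i; rewrite mxE.
apply: le_trans (ler_norm_sum _ _ _) _.
apply: (@le_trans _ _ ((\sum_j `|A i j|) * b)); last first.
  by rewrite ler_wpM2r // (le_bigmax 0 (fun i => \sum_j `|A i j|) i).
by rewrite mulr_suml ler_sum // => j _; rewrite normrM ler_wpM2l.
Qed.

Lemma infnorm_ge0 (R : realType) (m k : nat) (A : 'M[R]_(m, k)) : 0 <= infnorm A.
Proof.
by rewrite /infnorm; elim/big_ind: _ => // [a b a0 b0|i _];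
  rewrite ?le_max ?a0 // sumr_ge0.
Qed.

Lemma opnorm2_le (R : realType) (n : nat) (H : 'M[R]_n) (k : R) : 0 <= k ->
  (forall v, enorm (H *m v) <= k * enorm v) -> opnorm2 H <= k.
Proof.
move=> k0 Hk; apply: ge_sup; first by exists (enorm (H *m 0)), 0; rewrite /= ?enorm0.
move=> _ [v /= v1 <-]; apply: le_trans (Hk v) _.
by rewrite -[leRHS]mulr1 ler_wpM2l.
Qed.

(** * Directional derivatives, Taylor's inequality and the gradient of a quadratic *)

Section Calculus.
Variable (R : realType) (n : nat).
Implicit Types x d : 'cV[R]_n.

(** [grad] collects partial derivatives; linearity of the differential extends the formula to every
    direction. *)
Lemma derive_grad (f : 'cV[R]_n -> R) x d :
  differentiable f x -> 'D_d f x = dotv (grad f x) d.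
Proof.
move=> df; rewrite deriveE // [in LHS](matrix_sum_delta d) linear_sum dotvE.
apply: eq_bigr => i _; rewrite big_ord1 linearZ mxE deriveE // mulrC.
by congr (_ * _); rewrite [ord0]ord1.
Qed.

Lemma is_derive_ray (f : 'cV[R]_n -> R) x d (t : R) :
  differentiable f (x + t *: d) ->
  is_derive t 1 (fun s : R => f (x + s *: d)) (dotv (grad f (x + t *: d)) d).
Proof.
move=> df.
have E : (fun h : R => h^-1 *: (((fun s : R => f (x + s *: d)) \o shift t) (h *: 1)
    - f (x + t *: d)))
  = (fun h : R => h^-1 *: ((f \o shift (x + t *: d)) (h *: d) - f (x + t *: d))).
  apply/funext => h /=; congr (_ *: (f _ - _)).
  by rewrite [h *: 1]mulr1 scalerDl addrCA addrA.
have dvb : derivable f (x + t *: d) d by apply: diff_derivable.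
split; first by rewrite /derivable E.
by rewrite /derive E -derive_grad.
Qed.

(** The mean value theorem is applied to a function that already contains the quadratic term
    [t ^+ 2 * b], which yields the factor 1/2 without integration. *)
Lemma taylor1_le (f : 'cV[R]_n -> R) (L : R) x y :
  (forall z, differentiable f z) ->
  (forall z w, enorm (grad f z - grad f w) <= L * enorm (z - w)) ->
  `|f y - f x - dotv (grad f x) (y - x)| <= L / 2 * enorm (y - x) ^+ 2.
Proof.
move=> df lip; set d := y - x; set a := dotv _ d.
set b := L / 2 * enorm d ^+ 2.
(* The values 1 and -1 of [s] give the two sides of the absolute value. *)
suff bound (s : R) : `|s| <= 1 -> s * (f y - f x - a) <= b.
  rewrite ler_norml lerNl -mulN1r -[X in _ && (X <= _)]mul1r.
  by rewrite !bound ?normrN1 ?normr1.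
move=> s1.
(* [phi] is nonincreasing on [0, 1], since [2 * b = L * |d|^2]. *)
pose phi (t : R) := s * (f (x + t *: d) - t * a) - t ^+ 2 * b.
pose dphi (t : R) := s * (dotv (grad f (x + t *: d)) d - a) - 2 * t * b.
have dph (t : R) : is_derive t (1 : R) phi (dphi t).
  have i1 := is_derive_ray (df (x + t *: d)).
  have i2 : is_derive t (1 : R) (fun t : R => t * a) a.
    by apply: is_derive_eq; rewrite /GRing.scale /= mulr1 mulr0 add0r.
  have i3 : is_derive t (1 : R) (fun t : R => t ^+ 2 * b) (2 * t * b).
    apply: is_derive_eq; rewrite /GRing.scale /=; ring.
  exact: is_deriveB (is_deriveZ s (is_deriveB i1 i2)) i3.
have xd : x + d = y by rewrite addrC subrK.
have [] := @MVT_segment R phi dphi 0 1 ler01 (fun t _ => dph t).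
  by apply: derivable_within_continuous => t _; exact: ex_derive.
move=> t; rewrite in_itv /= => /andP[t0 t1].
rewrite /phi /dphi subr0 mulr1 scale0r scale1r addr0 mul0r subr0 mul1r.
rewrite expr1n expr0n /= !mul0r subr0 mul1r xd => e.
have : s * (dotv (grad f (x + t *: d)) d - a) <= 2 * t * b.
  apply: le_trans (ler_norm _) _; rewrite normrM.
  apply: (@le_trans _ _ (1 * `|dotv (grad f (x + t *: d)) d - a|)).
    by rewrite ler_wpM2r.
  rewrite mul1r -dotvBl; apply: le_trans (normr_dotv_le _ _) _.
  apply: (@le_trans _ _ (L * enorm (t *: d) * enorm d)).
    rewrite ler_wpM2r ?enorm_ge0 //; apply: le_trans (lip _ _) _.
    by rewrite addrAC subrr add0r.
  rewrite enormZ ger0_norm // /b; lra.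
lra.
Qed.

(** For [h != 0] the difference quotient is exactly affine in [h], so its limit is the constant
    term; symmetry of [H] merges the two cross terms. *)
Lemma grad_quad c (g : 'cV[R]_n) (H : 'M[R]_n) x y : H^T = H ->
  grad (quad c g H x) y = g + H *m (y - x).
Proof.
move=> symH; apply/matrixP => i j; rewrite ord1 !mxE.
set e : 'cV[R]_n := delta_mx i 0.
have E (h : R) : h != 0 ->
  h^-1 *: ((quad c g H x \o shift y) (h *: e) - quad c g H x y)
  = g i 0 + (H *m (y - x)) i 0 + h * (2^-1 * dotv e (H *m e)).
  move=> h0; rewrite /= /quad -!mulmxA -!/(dotv _ _).
  rewrite (_ : h *: e + y - x = h *: e + (y - x)); last by rewrite addrA.
  move: (y - x) => u; rewrite mulmxDr -scalemxAr !dotvDl !dotvDr !dotvZl !dotvZr.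
  rewrite [dotv u (H *m e)]dotv_mulmx symH !(dotvC _ e) !dotv_deltal /GRing.scale /=.
  by field.
have -> : \sum_j H i j * (y - x) j 0 = (H *m (y - x)) i 0 by rewrite mxE.
rewrite /derive; apply: cvg_lim => //.
set l := g i 0 + _; set q := 2^-1 * _ in E.
apply: (@cvg_trans _ ((l + h * q) @[h --> (0 : R)^'])).
  apply: near_eq_cvg; near=> h; rewrite /= E //.
  by near: h; exact: nbhs_dnbhs_neq.
suff : l + h * q @[h --> (0 : R)^'] --> l + 0 * q by rewrite mul0r addr0.
apply: cvgD; first exact: cvg_cst.
apply: cvgM; last exact: cvg_cst.
exact: nbhs_dnbhs.
Unshelve. all: by end_near. Qed.

End Calculus.

(** * The KKT system and the Hessian of the interpolant *)

Section InterpolationSystem.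
Variables (R : realType) (n p : nat) (x : 'cV[R]_n) (Delta : R).
Variable Y : 'I_p -> 'cV[R]_n.
Local Notation s := (shat x Delta Y).
Local Notation M := (Mhat x Delta Y).
Local Notation P := (Phat x Delta Y).
Local Notation F := (Fhat x Delta Y).

Lemma quadE c (g : 'cV[R]_n) (H : 'M[R]_n) y :
  quad c g H x y = c + dotv g (y - x) + 2^-1 * dotv (y - x) (H *m (y - x)).
Proof. by rewrite /quad -mulmxA. Qed.

Lemma Mhat_mul_col (c : R) (u : 'cV[R]_n) i :
  (M *m col_mx c%:M u) i 0 = c + dotv (s i) u.
Proof.
rewrite /Mhat mul_row_col mxE; congr (_ + _).
  by rewrite mxE big_ord1 !mxE mul1r mulr1n.
by rewrite mxE dotvE; apply: eq_bigr => j _; rewrite mxE.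
Qed.

(** Padding a kernel vector of [Mhat] with a zero block gives a kernel vector of the invertible
    [Fhat]. *)
Lemma Mhat_inj (z : 'cV[R]_(1 + n)) : F \in unitmx -> M *m z = 0 -> z = 0.
Proof.
move=> uF Mz.
have Fz : F *m col_mx 0 z = 0.
  by rewrite /Fhat mul_block_col !mulmx0 mul0mx Mz !addr0 col_mx0.
apply/eqP; have /eqP : col_mx (0 : 'cV[R]_p) z = 0.
  by rewrite -[LHS](mulKmx uF) Fz mulmx0.
by rewrite col_mx_eq0 => /andP[].
Qed.

(** By [M *m Md *m M = M], the difference of the two sides lies in the kernel of [M], which is
    trivial. *)
Lemma MP_pinv_mulK (Md : 'M[R]_(1 + n, p)) (z : 'cV[R]_(1 + n)) :
  F \in unitmx -> is_MP_pinv M Md -> Md *m (M *m z) = z.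
Proof.
move=> uF [MMdM _ _ _]; apply/eqP; rewrite -subr_eq0; apply/eqP.
by apply: Mhat_inj => //; rewrite mulmxBr !mulmxA MMdM subrr.
Qed.

(** Turns Frobenius pairings with rank-one matrices into values of a quadratic form, which the
    interpolation conditions control. *)
Lemma frob_rank1 (u : 'cV[R]_n) (D : 'M[R]_n) :
  \sum_k \sum_l (u *m u^T) k l * D k l = dotv u (D *m u).
Proof.
rewrite dotvE; apply: eq_bigr => k _; rewrite mxE mulr_sumr.
by apply: eq_bigr => l _; rewrite mxE big_ord1 mxE -mulrA [u l _ * _]mulrC.
Qed.

(* [lam] is the multiplier vector of the KKT system for the residual of the data
   with respect to an arbitrary affine function. The proof is Pythagoras: a
   feasible Hessian differs from the KKT one by a Frobenius-orthogonal matrix. *)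
Lemma mfn_hessianE (v : 'I_p -> R) c g H (a : R) (b : 'cV[R]_n) :
  0 < Delta -> F \in unitmx -> is_mfn_interp x Y v c g H ->
  let r := \col_i (v i - a - dotv b (Y i - x)) in
  let lam := usubmx (invmx F *m col_mx r 0) in
  H = \sum_i (lam i 0 / Delta ^+ 2) *: (s i *m (s i)^T).
Proof.
move=> D0 uF [symH interpH minH] r lam.
have DN0 : Delta != 0 by rewrite gt_eqF.
set H0 := RHS; set z := dsubmx (invmx F *m col_mx r 0).
have : F *m col_mx lam z = col_mx r 0 by rewrite vsubmxK mulKVmx.
rewrite /Fhat mul_block_col mul0mx addr0 => /eq_col_mx[Pz Mlam].
clearbody lam z.
have dE i : Y i - x = Delta *: s i by rewrite scalerA divff // scale1r.
have symH0 : H0^T = H0.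
  rewrite linear_sum; apply: eq_bigr => i _.
  by rewrite linearZ /= trmx_mul trmxK.
have quadH0 i : dotv (s i) (H0 *m s i) = 2 / Delta ^+ 2 * (P *m lam) i 0.
  rewrite mulmx_suml /dotv mulmx_sumr summxE mxE mulr_sumr.
  apply: eq_bigr => j _; rewrite -scalemxAl -scalemxAr mxE -mulmxA.
  rewrite [_^T *m s i]mx11_scalar mul_mx_scalar -scalemxAr [in LHS]mxE [P _ _]mxE.
  rewrite -!/(dotv _ _) (dotvC (s j) (s i)). by field.
(* Feasibility of [H0]: [z] supplies the affine part, [Delta^-1] undoes the scaling of the gradient,
   and [a], [b] restore the subtracted affine function. *)
have interpH0 i : quad (a + usubmx z 0 0) (b + Delta^-1 *: dsubmx z) H0 x (Y i) = v i.
  have : (P *m lam) i 0 + (usubmx z 0 0 + dotv (s i) (dsubmx z))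
      = v i - a - Delta * dotv b (s i).
    rewrite -Mhat_mul_col -mx11_scalar vsubmxK; transitivity (r i 0).
      by rewrite -Pz [RHS]mxE.
    by rewrite mxE dE dotvZr.
  move: (quadH0 i); rewrite quadE dE.
  move: (s i) ((P *m lam) i 0) => si Pl q e.
  rewrite dotvDl -!scalemxAr !dotvZl !dotvZr q (dotvC (dsubmx z)).
  have -> : v i = v i - a - Delta * dotv b si + (a + Delta * dotv b si) by ring.
  by rewrite -e; field.
have minH0 := minH _ _ _ symH0 interpH0.
set D := H - H0.
have HE : H = H0 + D by rewrite addrC subrK.
(* Scaled difference of the two affine parts. Both quadratics take the same values at the points, so
   [M *m w] is determined by the quadratic form of [D]. *)
pose w := col_mx (c - (a + usubmx z 0 0))%:M
  (Delta *: (g - (b + Delta^-1 *: dsubmx z))).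
have Mw i : (M *m w) i 0 = - (Delta ^+ 2 / 2) * dotv (s i) (D *m s i).
  have := interpH i; rewrite -(interpH0 i) !quadE dE Mhat_mul_col.
  move: (s i) => si; rewrite -!scalemxAr !dotvZl !dotvZr.
  by rewrite [D *m si]mulmxBl !dotvBr (dotvC si g) (dotvC si (b + _)) => e; lra.
(* The pairing is a multiple of [lam^T *m M *m w], which vanishes by the second KKT block
   [M^T *m lam = 0]. *)
have orth : \sum_k \sum_l H0 k l * D k l = 0.
  transitivity (- (2 / Delta ^+ 4) * (lam^T *m (M *m w)) 0 0); last first.
    by rewrite mulmxA -[M]trmxK -trmx_mul Mlam trmx0 mul0mx mxE mulr0.
  transitivity (\sum_i (lam i 0 / Delta ^+ 2) * dotv (s i) (D *m s i)); last first.
    rewrite mxE mulr_sumr; apply: eq_bigr => i _.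
    by rewrite Mw mxE; field.
  under [RHS]eq_bigr do rewrite -frob_rank1 mulr_sumr.
  rewrite [RHS]exchange_big /=; apply: eq_bigr => k _.
  under [RHS]eq_bigr do rewrite mulr_sumr.
  rewrite [RHS]exchange_big /=; apply: eq_bigr => l _.
  rewrite /H0 summxE mulr_suml; apply: eq_bigr => i _.
  by rewrite [X in X * _]mxE mulrA.
have pyth : frob2 H = frob2 H0 + frob2 D.
  rewrite -[RHS]addr0 -(mulr0 2) -orth /frob2 mulr_sumr -!big_split /=.
  apply: eq_bigr => k _; rewrite mulr_sumr -!big_split /=.
  by apply: eq_bigr => l _; rewrite {1}HE mxE; ring.
have D2 k l : 0 <= D k l ^+ 2 by exact: sqr_ge0.
(* Minimality gives [frob2 H <= frob2 H0], which [pyth] allows only for [D = 0]. *)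
have : frob2 D == 0.
  have : 0 <= frob2 D by do 2!apply: sumr_ge0 => ? _.
  rewrite eq_le => ->; rewrite andbT; lra.
rewrite psumr_eq0 => [/allP Dk|k _]; last by apply: sumr_ge0.
rewrite [LHS]HE; apply/matrixP => k l; rewrite mxE.
have /= := Dk k (mem_index_enum _).
rewrite psumr_eq0 // => /allP/(_ l (mem_index_enum _)) /=.
by rewrite sqrf_eq0 => /eqP->; rewrite addr0.
Qed.

(** Each summand maps [u] to a multiple of [s i] with coefficient
    [lam i / Delta ^+ 2 * dotv (s i) u]; Cauchy-Schwarz and the triangle inequality finish. *)
Lemma rank1_sum_mulmx_le (lam : 'I_p -> R) (beta B : R) (u : 'cV[R]_n) :
  (forall i, enorm (s i) <= beta) -> (forall i, `|lam i| <= B) ->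
  enorm ((\sum_i (lam i / Delta ^+ 2) *: (s i *m (s i)^T)) *m u)
    <= p%:R * (B / Delta ^+ 2 * beta ^+ 2) * enorm u.
Proof.
move=> sb lamB; rewrite mulmx_suml; apply: le_trans (enorm_sum _) _.
rewrite -mulrA -[X in X%:R * _]card_ord mulr_natl -sumr_const; apply: ler_sum => i _.
rewrite -scalemxAl -mulmxA [_^T *m u]mx11_scalar mul_mx_scalar enormZ enormZ.
rewrite -/(dotv (s i) u) -[leRHS]mulrA; apply: ler_pM; rewrite ?mulr_ge0 ?enorm_ge0 //.
  rewrite normrM [`|_^-1|]ger0_norm ?invr_ge0 ?sqr_ge0 //.
  by apply: ler_wpM2r; rewrite ?invr_ge0 ?sqr_ge0 ?lamB.
apply: (@le_trans _ _ (enorm (s i) * enorm u * enorm (s i))).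
  by rewrite ler_wpM2r ?enorm_ge0 ?normr_dotv_le.
rewrite mulrAC -expr2 ler_wpM2r ?enorm_ge0 // ler_pXn2r ?nnegrE ?enorm_ge0 //.
by apply: le_trans (sb i); apply: enorm_ge0.
Qed.

End InterpolationSystem.
End MinimumFrobeniusNorm.

(** * Assembly of the error bounds *)

Theorem theorem8p4 (R : realType) (n p : nat)
  (hp1 : (n + 2 <= p)%N) (hp2 : (p <= (n + 1) * (n + 2) %/ 2 - 1)%N)
  (f ftilde : 'cV[R]_n -> R) (Lg epsf : R)
  (hbdd : exists b : R, forall z, b <= f z)
  (hdiff : forall z, differentiable f z)
  (hL0 : 0 <= Lg)
  (hLip : forall z w, enorm (grad f z - grad f w) <= Lg * enorm (z - w))
  (heps : 0 < epsf) (hft : forall z, `|ftilde z - f z| <= epsf)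
  (x : 'cV[R]_n) (Delta beta : R) (hDelta : 0 < Delta) (hbeta : 0 < beta)
  (Y : 'I_p -> 'cV[R]_n) (hY : forall i, enorm (Y i - x) <= beta * Delta)
  (hF : Fhat x Delta Y \in unitmx)
  (Md : 'M[R]_(1 + n, p)) (hMd : is_MP_pinv (Mhat x Delta Y) Md)
  (c : R) (g : 'cV[R]_n) (H : 'M[R]_n)
  (hm : is_mfn_interp x Y (fun i => ftilde (Y i)) c g H) :
  let NF := infnorm (invmx (Fhat x Delta Y)) in
  let NM := infnorm Md in
  let kH := Lg / 2 * p%:R * beta ^+ 4 * NF + epsf / Delta ^+ 2 * p%:R * beta ^+ 2 * NF in
  let kmf := (Lg + kH) / 2 * (1 + Num.sqrt n%:R) * beta ^+ 2 * NM + (Lg + kH) / 2 in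
  let tkmf := (1 + Num.sqrt n%:R) * NM in
  let kmg := 2 * kmf + 2 * kH in
  let tkmg := 2 * tkmf in
  let m := quad c g H x in
  opnorm2 H <= kH /\
  forall y, enorm (y - x) <= Delta ->
    `|m y - f y| <= kmf * Delta ^+ 2 + tkmf * epsf /\
    enorm (grad m y - grad f y) <= kmg * Delta + tkmg * epsf / Delta.
Proof.
move=> NF NM kH kmf tkmf kmg tkmg m.
have NF0 : 0 <= NF by apply: infnorm_ge0.
have NM0 : 0 <= NM by apply: infnorm_ge0.
have DN0 : Delta != 0 by rewrite gt_eqF.
have e0 := ltW heps; have b0 := ltW hbeta; have D0 := ltW hDelta.
have kH0 : 0 <= kH by rewrite /kH addr_ge0 ?(mulr_ge0, invr_ge0, exprn_ge0, ler0n).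
have d2 i : enorm (Y i - x) ^+ 2 <= beta ^+ 2 * Delta ^+ 2.
  by rewrite -exprMn ler_pXn2r ?nnegrE ?enorm_ge0 ?mulr_ge0.
pose res i := ftilde (Y i) - f x - dotv (grad f x) (Y i - x).
(* Taylor remainder at distance at most [beta * Delta], plus the noise level. *)
pose B := Lg / 2 * beta ^+ 2 * Delta ^+ 2 + epsf.
have B0 : 0 <= B by rewrite /B addr_ge0 ?(mulr_ge0, invr_ge0, exprn_ge0).
have resB i : `|res i| <= B.
  have t := taylor1_le x (Y i) hdiff hLip.
  have -> : res i = (f (Y i) - f x - dotv (grad f x) (Y i - x))
    + (ftilde (Y i) - f (Y i)) by rewrite /res; ring.
  apply: le_trans (ler_normD _ _) _; rewrite lerD // (le_trans t) //.
  by rewrite -[leRHS]mulrA ler_wpM2l ?divr_ge0.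
have sb i : enorm (shat x Delta Y i) <= beta.
  rewrite enormZ ger0_norm ?invr_ge0 // ler_pdivrMl //.
  by rewrite mulrC.
have Hv v : enorm (H *m v) <= kH * enorm v.
  rewrite (mfn_hessianE (f x) (grad f x) hDelta hF hm).
  set lam := usubmx _.
  have lamB i : `|lam i 0| <= NF * B.
    rewrite mxE; apply: infnorm_mulmx_le => // j.
    rewrite -(splitK j); case: (fintype.split j) => k /=.
      by rewrite col_mxEu mxE resB.
    by rewrite col_mxEd mxE normr0.
  apply: le_trans (rank1_sum_mulmx_le v sb lamB) _.
  (* With multipliers bounded by [NF * B], the rank-one bound equals [kH] exactly. *)
  rewrite ler_wpM2r ?enorm_ge0 // le_eqVlt; apply/orP; left; apply/eqP.
  by rewrite /kH /B; field.
split; first exact: opnorm2_le.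
have dHd d : `|dotv d (H *m d)| <= kH * enorm d ^+ 2.
  apply: le_trans (normr_dotv_le _ _) _.
  by rewrite mulrC expr2 mulrA ler_wpM2r ?enorm_ge0.
case: hm => symH interpH _.
(* Adds to [B] the contribution of the quadratic term of the model at the points. *)
pose B2 := B + kH / 2 * beta ^+ 2 * Delta ^+ 2.
have B20 : 0 <= B2 by rewrite /B2 addr_ge0 ?(mulr_ge0, invr_ge0, exprn_ge0).
pose z : 'cV[R]_(1 + n) := col_mx (c - f x)%:M (Delta *: (g - grad f x)).
have MzB i : `|(Mhat x Delta Y *m z) i 0| <= B2.
  have -> : (Mhat x Delta Y *m z) i 0
      = res i - 2^-1 * dotv (Y i - x) (H *m (Y i - x)).
    rewrite Mhat_mul_col dotvZr /shat dotvZl mulrA divff // mul1r dotvBr.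
    rewrite /res -(interpH i) quadE (dotvC g) (dotvC (grad f x)); ring.
  apply: le_trans (ler_normB _ _) _; rewrite lerD // normrM ger0_norm //.
  have := dHd (Y i - x); have := ler_wpM2l kH0 (d2 i); lra.
have zB i : `|z i 0| <= NM * B2.
  by rewrite -(MP_pinv_mulK z hF hMd); apply: infnorm_mulmx_le.
have cB : `|c - f x| <= NM * B2.
  by have := zB (lshift n 0); rewrite col_mxEu mxE mulr1n.
have gB : Delta * enorm (g - grad f x) <= Num.sqrt n%:R * (NM * B2).
  rewrite -{1}(ger0_norm D0) -enormZ; apply: enorm_le_sqrt => i.
  by have := zB (rshift 1 i); rewrite col_mxEd.
have sn0 : 0 <= Num.sqrt (n%:R : R) by apply: sqrtr_ge0.
(* The stated bound splits into the error in the constant term, the error in the scaled gradient,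
   and the second-order terms of [f] and [m]. *)
have kmfE : kmf * Delta ^+ 2 + tkmf * epsf
    = NM * B2 + Num.sqrt n%:R * (NM * B2) + (Lg + kH) / 2 * Delta ^+ 2.
  by rewrite /kmf /tkmf /B2 /B; field.
move=> y yD; set d := y - x in yD *.
have dd : enorm d ^+ 2 <= Delta ^+ 2 by rewrite ler_pXn2r ?nnegrE ?enorm_ge0.
split.
  rewrite kmfE.
  have -> : m y - f y = (c - f x) + dotv (g - grad f x) d
      + 2^-1 * dotv d (H *m d) - (f y - f x - dotv (grad f x) d).
    by rewrite /m quadE -/d (dotvBl g); ring.
  have t := taylor1_le x y hdiff hLip.
  have gd : `|dotv (g - grad f x) d| <= Delta * enorm (g - grad f x).
    apply: le_trans (normr_dotv_le _ _) _.
    by rewrite mulrC ler_wpM2r ?enorm_ge0.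
  have h1 := ler_wpM2l kH0 dd; have h2 := ler_wpM2l hL0 dd; have h3 := dHd d.
  apply: le_trans (ler_normB _ _) _.
  apply: le_trans (lerD (ler_normD _ _) (lexx _)) _.
  apply: le_trans (lerD (lerD (ler_normD _ _) (lexx _)) (lexx _)) _.
  rewrite normrM [`|2^-1|]ger0_norm //; rewrite -/d in t; lra.
(* The gradient bound is twice the function bound over [Delta], plus [2 * kH * Delta]. *)
have -> : kmg * Delta + tkmg * epsf / Delta
    = Delta^-1 * (2 * (kmf * Delta ^+ 2 + tkmf * epsf)) + 2 * kH * Delta.
  by rewrite /kmg /tkmg; field.
rewrite kmfE /m grad_quad // -/d.
have -> : g + H *m d - grad f y = (g - grad f x) + H *m d - (grad f y - grad f x).
  by rewrite opprB addrA [g - _ + _]addrAC subrK.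
apply: le_trans (enormD _ _) _.
apply: le_trans (lerD (enormD _ _) (lexx _)) _.
have h1 : enorm (H *m d) <= kH * Delta by apply: le_trans (Hv d) _; rewrite ler_wpM2l.
have h2 : enorm (- (grad f y - grad f x)) <= Lg * Delta.
  rewrite opprB enormB; apply: le_trans (hLip y x) _; by rewrite ler_wpM2l.
have h3 : enorm (g - grad f x) <= Delta^-1 * (Num.sqrt n%:R * (NM * B2)).
  by rewrite ler_pdivlMl.
set N := NM * B2 in gB h3 *.
have N0 : 0 <= N by rewrite mulr_ge0.
(* The stated constants exceed the sum of [h1], [h2] and [h3]; [h4], [h5] and [h6] say that the
   surplus terms are nonnegative. *)
have h4 : 0 <= Delta^-1 * (Num.sqrt n%:R * N) by rewrite !mulr_ge0 ?invr_ge0.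
have h5 : 0 <= Delta^-1 * N by rewrite mulr_ge0 ?invr_ge0.
have h6 : 0 <= kH * Delta by rewrite mulr_ge0.
have -> : Delta^-1 * (2 * (N + Num.sqrt n%:R * N + (Lg + kH) / 2 * Delta ^+ 2))
   = 2 * (Delta^-1 * N) + 2 * (Delta^-1 * (Num.sqrt n%:R * N)) + (Lg + kH) * Delta.
  by field.
lra.
Qed.
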